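(* Let $\mathbf{T}(\nu)$ be the moment matrix associated with a positive measure $\nu$ with support on the unit circle $\mathbb{T}$. Let $\nu=\nu_a+\nu_s$ be the Lebesgue decomposition of $\nu$ with respect to the Lebesgue measure $\mathbf{m}$ on $\mathbb{T}$ ($\nu_a$ absolutely continuous and $\nu_s$ singular with respect to $\mathbf{m}$). Then $$\lim_{n\to\infty}\lambda_n(\nu)=\lim_{n\to\infty}\lambda_n(\nu_a).$$
   Context: For a positive Borel measure $\mu$ on $\mathbb{C}$ with finite moments, its moment matrix is $\mathbf{M}(\mu)=(c_{i,j})_{i,j=0}^\infty$ with $c_{i,j}=\int z^i\overline{z}^j\,d\mu(z)$; it is written $\mathbf{T}(\mu)$ when $\mu$ is supported on $\mathbb{T}=\{|z|=1\}$ (the matrix is then Toeplitz). $\lambda_n(\mu)$ denotes the smallest eigenvalue of the $(n+1)\times(n+1)$ truncation $(c_{i,j})_{i,j=0}^n$; the sequence $(\lambda_n(\mu))_n$ is non-increasing and non-negative, so it converges. $\mathbf{m}$ is the normalized Lebesgue (arc length) measure on $\mathbb{T}$. *)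

(* Defs.v *)
(* MathComp-Analysis, with the complex numbers R[i] of mathcomp-real-closed. *)
From HB Require Import structures.
From mathcomp Require Import all_boot all_order all_algebra.
From mathcomp Require Import all_classical all_reals all_analysis.
From mathcomp.real_closed Require Import complex.

Set Implicit Arguments.
Unset Strict Implicit.
Unset Printing Implicit Defensive.

Import Order.TTheory GRing.Theory Num.Theory.
Import numFieldNormedType.Exports.

Local Open Scope ring_scope.
Local Open Scope classical_set_scope.
Local Open Scope complex_scope.

(* R[i] has no topology of its own: it gets one as a numFieldType, from the
   norm, whence the cast. *)
Definition borelC (R : realType) : Type :=
  g_sigma_algebraType (@open (R[i] : numFieldType)).

HB.instance Definition _ (R : realType) := Measurable.on (borelC R).

Section MomentMatrix.
Context {R : realType}.
Implicit Types (mu : {measure set (borelC R) -> \bar R}) (f : borelC R -> R[i]).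

Definition cintegrable mu f : Prop :=
  mu.-integrable setT (fun z => (complex.Re (f z))%:E) /\
  mu.-integrable setT (fun z => (complex.Im (f z))%:E).

Definition cintegral mu f : R[i] :=
  (\int[mu]_z complex.Re (f z)) +i* (\int[mu]_z complex.Im (f z)).

Definition monomial (i j : nat) : borelC R -> R[i] :=
  fun z => (z : R[i]) ^+ i * ((z : R[i])^*) ^+ j.

Definition finite_moments mu : Prop :=
  forall i j : nat, cintegrable mu (monomial i j).

Definition moment_matrix mu (i j : nat) : R[i] :=
  cintegral mu (monomial i j).

Definition moment_trunc mu (n : nat) : 'M[R[i]]_n.+1 :=
  \matrix_(i < n.+1, j < n.+1) moment_matrix mu i j.

(* The truncations are Hermitian, so all their eigenvalues are real, and this
   infimum is a minimum (lambda_minimum below). *)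
Definition lambda mu (n : nat) : R :=
  inf [set x : R | eigenvalue (moment_trunc mu n) x%:C].

End MomentMatrix.

Lemma moment_trunc_hermitian (R : realType)
    (mu : {measure set (borelC R) -> \bar R}) (n : nat) :
  finite_moments mu ->
  moment_trunc mu n = (map_mx conjc (moment_trunc mu n))^T.
Proof.
move=> fm; apply/matrixP => i j; rewrite !mxE /moment_matrix /cintegral /=.
have E z : monomial i j z = ((monomial j i z)^*)%C.
  by rewrite /monomial rmorphM !rmorphXn /= conjcK mulrC.
have [_ mIm] := fm j i.
congr (_ +i* _)%C; first by apply: eq_Rintegral => z _; rewrite E; case: monomial.
rewrite -mulN1r -RintegralZl//.
by apply: eq_Rintegral => z _; rewrite E mulN1r; case: monomial.
Qed.

Lemma lambda_minimum (R : realType)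
    (mu : {measure set (borelC R) -> \bar R}) (n : nat) :
  finite_moments mu ->
  eigenvalue (moment_trunc mu n) (lambda mu n)%:C /\
  forall a, eigenvalue (moment_trunc mu n) a -> (lambda mu n)%:C <= a.
Proof.
move=> fm; have := moment_trunc_hermitian n fm; rewrite /lambda.
move: (moment_trunc mu n) => M hM.
have real a : eigenvalue M a -> exists x : R, a = x%:C.
  case/eigenvalueP => v vM v0.
  pose w := (map_mx conjc v)^T.
  have ww0 : (v *m w) 0 0 != 0.
    rewrite mxE psumr_eq0; last first.
      by move=> i _; rewrite !mxE; exact: (@mul_conjC_ge0 R[i] (v 0 i)).
    have /rV0Pn[i vi] := v0.
    apply/allPn; exists i; rewrite ?mem_index_enum//= !mxE.
    by rewrite mulf_neq0// conjc_eq0.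
  have e1 : v *m M *m w = a *: (v *m w) by rewrite vM scalemxAl.
  have e2 : v *m M *m w = a^*%C *: (v *m w).
    have Mw : M *m w = a^*%C *: w.
      by rewrite {1}hM -trmx_mul -map_mxM vM map_mxZ linearZ.
    by rewrite -mulmxA Mw -scalemxAr.
  have : a = a^*%C.
    by apply: (mulIf ww0); move: e1; rewrite e2 => /matrixP/(_ 0 0); rewrite !mxE.
  by case: a {vM e1 e2} => x y [] /eqP; rewrite -subr_eq0 opprK -mulr2n
    mulrn_eq0/= => /eqP ->; exists x.
have [s /= sE] := closed_field_poly_normal (char_poly M).
rewrite (monicP (char_poly_monic M)) scale1r in sE.
have evE a : eigenvalue M a = (a \in s).
  by rewrite eigenvalue_root_char sE root_prod_XsubC.
have [a0 ea0] := eigenvalue_closed M (ltn0Sn n).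
have [x0 ex0] := real _ ea0.
have mex : exists2 m : R, m%:C \in s & forall x : R, x%:C \in s -> m <= x.
  have : x0%:C \in s by rewrite -ex0 -evE.
  elim: {sE evE} s x0 {ea0 ex0} => // b s IH x0.
  have [[x xs]|nx] := pselect (exists x : R, x%:C \in s); last first.
    rewrite inE => /orP[/eqP <-|xs]; last by exfalso; apply: nx; exists x0.
    exists x0; rewrite ?mem_head// => x; rewrite inE => /orP[/eqP/complexI->//|xs].
    by exfalso; apply: nx; exists x.
  have [m ms mP] := IH _ xs => _.
  have [[y ?]|ny] := pselect (exists y : R, b = y%:C).
    subst b.
    have [my|ym] := leP m y.
      exists m; rewrite ?inE ?ms ?orbT// => z.
      by rewrite inE => /orP[/eqP/complexI->//|/mP].
    exists y; rewrite ?mem_head// => z; rewrite inE => /orP[/eqP/complexI->//|/mP].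
    exact/le_trans/ltW.
  exists m; rewrite ?inE ?ms ?orbT// => z; rewrite inE => /orP[/eqP zb|/mP//].
  by exfalso; apply: ny; exists z.
have [m ms mP] := mex.
have -> : inf [set x : R | eigenvalue M x%:C] = m.
  apply/eqP; rewrite eq_le; apply/andP; split.
    apply: ge_inf; last by rewrite /= evE.
    by exists m => x /=; rewrite evE => /mP.
  apply: lb_le_inf; first by exists m; rewrite /= evE.
  by move=> x /=; rewrite evE => /mP.
split; first by rewrite evE.
by move=> a ea; have [x ax] := real _ ea; rewrite ax lecR mP// -ax -evE.
Qed.

Section UnitCircle.
Context (R : realType).

Definition unit_circle : set (borelC R) := [set z | `|z : R[i]| = 1].

Definition expi (t : R) : borelC R := cos t +i* sin t.

Lemma lt0_2pi : (0 : R) < 2 * pi.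
Proof. by rewrite mulr_gt0// pi_gt0. Qed.

(* Normalized arc length, as a Borel measure on the whole of C. *)
Definition arc_measure : set (borelC R) -> \bar R :=
  pushforward (uniform_prob lt0_2pi) (expi : measurableTypeR R -> borelC R).

End UnitCircle.
Arguments unit_circle R : clear implicits.
Arguments arc_measure R : clear implicits.

Definition mutually_singular d (T : measurableType d) (R : realType)
    (mu nu : set T -> \bar R) : Prop :=
  exists N : set T, [/\ measurable N, mu N = 0%E & nu (~` N) = 0%E].

Definition lebesgue_decomposition d (T : measurableType d) (R : realType)
    (m : set T -> \bar R) (nu nu_a nu_s : {measure set T -> \bar R}) : Prop :=
  [/\ forall A, measurable A -> nu A = (nu_a A + nu_s A)%E,
      nu_a `<< m
    & mutually_singular nu_s m].

(* Main.v *)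
Require Import Defs.
From HB Require Import structures.
From mathcomp Require Import all_boot all_order all_algebra.
From mathcomp Require Import all_classical all_reals all_analysis.
From mathcomp.real_closed Require Import complex.
From mathcomp Require Import measurable_realfun ring lra.

Set Implicit Arguments.
Unset Strict Implicit.
Unset Printing Implicit Defensive.

Import Order.TTheory GRing.Theory Num.Theory.
Import numFieldNormedType.Exports.

Local Open Scope ring_scope.
Local Open Scope classical_set_scope.
Local Open Scope complex_scope.

(** The smallest eigenvalue of the truncated moment matrix of [mu] is the
    minimum of the integral of |p|^2 against [mu], over the polynomials [p] of
    degree at most [n] whose coefficient vector has norm 1 ([rayleigh_ge],
    [energy_quadratic_form]). The monomials are orthonormal for arc length, by
    [moment_matrix_arc], so the square of that norm is itself the integral of
    |p|^2 against arc length; the eigenvalue thus compares two energies of the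
    same polynomial ([lambda_energy_le], [lambda_energy_attained]). It follows
    at once that the eigenvalues decrease with [n] and increase with the
    measure, whence the convergence and the inequality between the limits for
    [nu_a] and [nu].

    For the other inequality, take [p] that realises the eigenvalue for [nu_a]
    and a Borel set [N] that carries arc length, hence [nu_a], and is null for
    [nu_s]. The function \1_N p has the energy of [p] for arc length, and its
    energy for [nu] is that of [p] for [nu_a]. It remains to approximate it by
    polynomials, in the mean square for arc length and [nu] together. As |p| is
    bounded on the circle it suffices to approximate \1_N by a trigonometric
    polynomial [g], since [z ^ k * g * p] is a polynomial for [k] large and has
    the same energies as [g * p] ([energy_indic_mul]).

    The indicators of Borel sets are mean square limits of trigonometric
    polynomials for every finite measure ([indic_approximable]). The sets with
    this property form a lambda-system by dominated convergence. It contains the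
    quadrants Re z < a, Im z < b: explicit polynomials converge on [0, 1] to the
    indicator of t < 1/2 ([cvg_step]), and substituting into them the
    trigonometric polynomials Re z and Im z, suitably rescaled, gives the
    indicator of a quadrant as a bounded pointwise limit. *)

(** * The Rayleigh quotient of a Hermitian matrix *)

Section Rayleigh.
Local Open Scope sesquilinear_scope.

(** In an orthonormal eigenbasis the quadratic form of [M] is a combination of
    eigenvalues weighted by the squared moduli of the coordinates of [v]. *)
Lemma rayleigh_ge (C : numClosedFieldType) n (M : 'M[C]_n) (l : C) :
  M \is hermsymmx -> (forall a, eigenvalue M a -> l <= a) ->
  forall v : 'rV[C]_n,
    l * (v *m v^t*) 0 0 <= (v *m M *m v^t*) 0 0.
Proof.
move=> hM lM v; set P := spectralmx M; set d := spectral_diag M.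
have PU : P \is unitarymx := spectral_unitarymx M.
have PV : P^t* *m P = 1%:M.
  by rewrite -invmx_unitary// mulVmx// unitarymx_unit.
have ME : M = P^t* *m diag_mx d *m P.
  by rewrite -invmx_unitary//; exact/orthomx_spectralP/hermitian_normalmx.
have ld i : l <= d 0 i.
  apply: lM; apply/eigenvalueP; exists (row i P); last first.
    apply/negP => /eqP Pi0.
    have /(congr1 (row i)) := unitarymxP PU.
    rewrite row_mul Pi0 mul0mx row1 => /matrixP/(_ 0 i).
    by rewrite !mxE !eqxx => /eqP; rewrite eq_sym oner_eq0.
  rewrite {1}ME !mulmxA -row_mul (unitarymxP PU).
  rewrite row1 -mulmxA -rowE mul_diag_mx.
  by apply/rowP => j; rewrite !mxE.
pose w := v *m P^t*.
have wE : w^t* = P *m v^t* by rewrite trmx_mul map_mxM/= trmxCK.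
have -> : v *m v^t* = w *m w^t* by rewrite wE /w -mulmxA (mulmxA _ P) PV mul1mx.
have -> : v *m M *m v^t* = w *m diag_mx d *m w^t*.
  by rewrite wE {1}ME /w !mulmxA.
rewrite mul_mx_diag !(@mxE _ 1 1) mulr_sumr; apply: ler_sum => i _.
rewrite [_^t* _ _]mxE [_^T _ _]mxE [X in _ <= X * _]mxE.
rewrite [X in _ <= X](_ : _ = d 0 i * (w 0 i * (w 0 i)^*)).
  by rewrite ler_wpM2r// mul_conjC_ge0.
by rewrite mulrA (mulrC (w 0 i)).
Qed.

End Rayleigh.

(** * The smallest eigenvalue as a minimum of energies *)

Section IntegrableReal.
Context d (T : measurableType d) (R : realType).
Variables (mu : {measure set T -> \bar R}) (D : set T).
Hypothesis mD : measurable D.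
Implicit Types h k : T -> R.

Lemma integrable_scale h (c : R) : mu.-integrable D (EFin \o h) ->
  mu.-integrable D (EFin \o (fun z => c * h z)).
Proof.
move=> ih; rewrite (_ : _ \o _ = (fun z => c%:E * (EFin \o h) z)%E).
  exact: integrableZl.
by apply/funext => z /=; rewrite EFinM.
Qed.

Lemma integrable_add h k :
  mu.-integrable D (EFin \o h) -> mu.-integrable D (EFin \o k) ->
  mu.-integrable D (EFin \o (fun z => h z + k z)).
Proof.
move=> ih ik; rewrite (_ : _ \o _ = ((EFin \o h) \+ (EFin \o k))%E).
  exact: integrableD.
by apply/funext => z /=; rewrite EFinD.
Qed.

End IntegrableReal.

Section NormSquare.
Context {R : realType}.
Implicit Types z : R[i].

Definition normsq z : R := complex.Re z ^+ 2 + complex.Im z ^+ 2.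

Lemma normsqE z : (normsq z)%:C = `|z| ^+ 2.
Proof. exact: add_Re2_Im2. Qed.

Lemma normsq_ge0 z : 0 <= normsq z.
Proof. by rewrite addr_ge0 ?sqr_ge0. Qed.

Lemma normsqM z1 z2 : normsq (z1 * z2) = normsq z1 * normsq z2.
Proof. by apply: complexI; rewrite rmorphM/= !normsqE normrM exprMn. Qed.

Lemma normsq_real (x : R) : normsq x%:C = x ^+ 2.
Proof. by rewrite /normsq/= expr0n addr0. Qed.

End NormSquare.

Section Energy.
Context {R : realType}.
Implicit Types (mu : {measure set (borelC R) -> \bar R}) (f : borelC R -> R[i]).

Lemma cintegrable0 mu : cintegrable mu (fun=> 0).
Proof. by split; exact: integrable0. Qed.

Lemma cintegrableD mu f g : cintegrable mu f -> cintegrable mu g ->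
  cintegrable mu (fun z => f z + g z).
Proof.
move=> [fr fi] [gr gi]; split.
- rewrite (_ : (fun _ => _) = EFin \o (fun z =>
    complex.Re (f z) + complex.Re (g z))); first exact: integrable_add.
  by apply/funext => z /=; case: (f z); case: (g z).
- rewrite (_ : (fun _ => _) = EFin \o (fun z =>
    complex.Im (f z) + complex.Im (g z))); first exact: integrable_add.
  by apply/funext => z /=; case: (f z); case: (g z).
Qed.

Lemma cintegralD mu f g : cintegrable mu f -> cintegrable mu g ->
  cintegral mu (fun z => f z + g z) = cintegral mu f + cintegral mu g.
Proof.
move=> [fr fi] [gr gi]; rewrite /cintegral.
apply/eqP; rewrite eq_complex/=; apply/andP; split; apply/eqP.
- rewrite -RintegralD//; apply: eq_Rintegral => z _.
  by case: (f z); case: (g z).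
- rewrite -RintegralD//; apply: eq_Rintegral => z _.
  by case: (f z); case: (g z).
Qed.

Lemma cintegrableZ mu (c : R[i]) f : cintegrable mu f ->
  cintegrable mu (fun z => c * f z).
Proof.
case: c => a b [fr fi]; split.
- rewrite (_ : (fun _ => _) = EFin \o (fun z =>
    a * complex.Re (f z) + - b * complex.Im (f z))).
    by apply: integrable_add => //; exact: integrable_scale.
  by apply/funext => z /=; case: (f z) => u v /=; rewrite mulNr.
- rewrite (_ : (fun _ => _) = EFin \o (fun z =>
    a * complex.Im (f z) + b * complex.Re (f z))).
    by apply: integrable_add => //; exact: integrable_scale.
  by apply/funext => z /=; case: (f z) => u v.
Qed.

Lemma cintegralZ mu (c : R[i]) f : cintegrable mu f ->
  cintegral mu (fun z => c * f z) = c * cintegral mu f.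
Proof.
case: c => a b [fr fi]; rewrite /cintegral.
apply/eqP; rewrite eq_complex/=; apply/andP; split; apply/eqP.
- rewrite -mulNr -!RintegralZl// -RintegralD//; try exact: integrable_scale.
  by apply: eq_Rintegral => z _; case: (f z) => u v /=; rewrite mulNr.
- rewrite -!RintegralZl// -RintegralD//; try exact: integrable_scale.
  by apply: eq_Rintegral => z _; case: (f z).
Qed.

Lemma cintegrable_sum mu I (s : seq I) (F : I -> borelC R -> R[i]) :
  (forall i, cintegrable mu (F i)) ->
  cintegrable mu (fun z => \sum_(i <- s) F i z).
Proof.
move=> iF; elim: s => [|i s IH].
  by under eq_fun do rewrite big_nil; exact: cintegrable0.
by under eq_fun do rewrite big_cons; exact: cintegrableD.
Qed.

Lemma cintegral_sum mu I (s : seq I) (F : I -> borelC R -> R[i]) :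
  (forall i, cintegrable mu (F i)) ->
  cintegral mu (fun z => \sum_(i <- s) F i z) =
  \sum_(i <- s) cintegral mu (F i).
Proof.
move=> iF; elim: s => [|i s IH].
  under eq_fun do rewrite big_nil.
  by rewrite big_nil /cintegral /Rintegral integral0.
under eq_fun do rewrite big_cons.
by rewrite big_cons cintegralD// ?IH//; exact: cintegrable_sum.
Qed.

Definition energy mu (p : {poly R[i]}) : R :=
  \int[mu]_z normsq p.[z : R[i]].

Lemma energy_ge0 mu p : 0 <= energy mu p.
Proof. by apply: Rintegral_ge0 => z _; exact: normsq_ge0. Qed.

Local Open Scope sesquilinear_scope.

Lemma normsq_horner n (p : {poly R[i]}) (z : borelC R) : (size p <= n)%N ->
  (normsq p.[z : R[i]])%:C =
  \sum_(j < n) \sum_(i < n) (p`_i * (p`_j)^*) * monomial i j z.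
Proof.
move=> sp; rewrite normsqE sqr_normc (horner_coef_wide _ sp) rmorph_sum/=.
rewrite mulr_sumr; apply: eq_bigr => j _; rewrite mulr_suml.
by apply: eq_bigr => i _; rewrite rmorphM rmorphXn/= /monomial; ring.
Qed.

Lemma energy_integrable mu p : finite_moments mu ->
  mu.-integrable setT (fun z => (normsq p.[z : R[i]])%:E).
Proof.
move=> fm.
suff [+ _] : cintegrable mu (fun z => (normsq p.[z : R[i]])%:C) by [].
rewrite (funext (fun z => normsq_horner z (leqnn (size p)))).
apply: cintegrable_sum => j; apply: cintegrable_sum => i.
exact: cintegrableZ.
Qed.

(** The quadratic form of the truncated moment matrix is the squared norm in
    [L^2(mu)] of the polynomial whose coefficients are the given vector. *)
Lemma energy_quadratic_form mu n (v : 'rV[R[i]]_n.+1) : finite_moments mu ->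
  (v *m moment_trunc mu n *m v^t*) 0 0 = (energy mu (rVpoly v))%:C.
Proof.
move=> fm.
have iF (j i : 'I_n.+1) : cintegrable mu
    (fun z => ((rVpoly v)`_i * ((rVpoly v)`_j)^*) * monomial i j z).
  exact: cintegrableZ.
transitivity (cintegral mu (fun z => (normsq (rVpoly v).[z : R[i]])%:C)).
  rewrite (funext (fun z => normsq_horner z (size_poly _ _))).
  rewrite cintegral_sum; last by move=> j; exact: cintegrable_sum.
  rewrite mxE; apply: eq_bigr => j _; rewrite cintegral_sum//.
  rewrite !mxE mulr_suml; apply: eq_bigr => i _.
  by rewrite cintegralZ// !mxE /moment_matrix !coef_rVpoly_ord mulrAC.
by rewrite /cintegral/= /Rintegral integral0.
Qed.

Lemma moment_trunc_hermsymmx mu n : finite_moments mu ->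
  moment_trunc mu n \is hermsymmx.
Proof.
move=> fm; apply/is_hermitianmxP; rewrite expr0 scale1r.
by rewrite {1}(moment_trunc_hermitian n fm) map_trmx.
Qed.

(** When the moment matrix of [m] is the identity, the squared norm of the
    coefficient vector of [p] is the energy of [p] for [m]. Stating the
    variational characterisation of the smallest eigenvalue through [m] frees it
    from coefficients: a bound then only has to compare two integrals. *)
Lemma lambda_energy_le (m mu : {measure set (borelC R) -> \bar R}) n
    (p : {poly R[i]}) :
  finite_moments m -> moment_trunc m n = 1%:M -> finite_moments mu ->
  (size p <= n.+1)%N -> lambda mu n * energy m p <= energy mu p.
Proof.
move=> fm m1 fmu sp; rewrite -lecR rmorphM/=.
rewrite -(poly_rV_K sp) -!energy_quadratic_form// m1 mulmx1.
apply: rayleigh_ge; first exact: moment_trunc_hermsymmx.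
by case: (lambda_minimum n fmu).
Qed.

Lemma lambda_energy_attained (m mu : {measure set (borelC R) -> \bar R}) n :
  finite_moments m -> moment_trunc m n = 1%:M -> finite_moments mu ->
  exists p : {poly R[i]}, [/\ (size p <= n.+1)%N, 0 < energy m p &
    energy mu p = lambda mu n * energy m p].
Proof.
move=> fm m1 fmu; have [/eigenvalueP[v vM v0] _] := lambda_minimum n fmu.
exists (rVpoly v); split; first exact: size_poly.
- rewrite -ltcR -energy_quadratic_form// m1 mulmx1 mxE.
  have [i vi] := rV0Pn _ v0.
  rewrite (bigD1 i)//= ltr_pwDl//.
    by rewrite !mxE mul_conjC_gt0.
  by apply: sumr_ge0 => j _; rewrite !mxE mul_conjC_ge0.
- apply: complexI; rewrite rmorphM/= -!energy_quadratic_form//.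
  by rewrite m1 mulmx1 vM -scalemxAl mxE.
Qed.

End Energy.

(** * Borel sets of the complex plane *)

Section ComplexBorel.
Context {R : realType}.
Implicit Types (z w : R[i]) (U : set (R[i] : numFieldType)).

Lemma normc_le_ReIm z : `|z| <= (`|complex.Re z| + `|complex.Im z|)%:C.
Proof.
rewrite {1}(complexE z); apply: le_trans (ler_normD _ _) _.
rewrite normrM rmorphD/= !normc_def /= !expr0n/= !addr0 !add0r expr1n sqrtr1.
rewrite mul1r.
by rewrite !sqrtr_sqr.
Qed.

Lemma normc_ge_Im z : `|complex.Im z|%:C <= `|z|.
Proof. by rewrite normc_def lecR -sqrtr_sqr ler_wsqrtr// lerDr sqr_ge0. Qed.

Lemma open_box U z : open U -> U z -> exists2 r : R, 0 < r &
  forall w, `|complex.Re w - complex.Re z| < r ->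
    `|complex.Im w - complex.Im z| < r -> U w.
Proof.
rewrite openE => /(_ z) + Uz => /(_ Uz) /nbhs_ballP[[e e'] /=].
rewrite ltcE/= => /andP[/eqP -> e0] eU.
exists (e / 2); first by rewrite divr_gt0.
move=> w rew imw; apply: eU; rewrite -ball_normE/= distrC.
apply: le_lt_trans (normc_le_ReIm _) _; rewrite ltcR [ltRHS]splitr.
by case: w z rew imw {Uz} => [a b] [c d]/= rew imw; rewrite ltrD.
Qed.

Lemma normr_Re_le1 z : `|z| = 1 -> `|complex.Re z| <= 1.
Proof.
by move=> z1; rewrite -lecR; apply: le_trans (normc_ge_Re z) _; rewrite z1.
Qed.

Lemma normr_Im_le1 z : `|z| = 1 -> `|complex.Im z| <= 1.
Proof.
by move=> z1; rewrite -lecR; apply: le_trans (normc_ge_Im z) _; rewrite z1.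
Qed.

Lemma open_Re_lt (a : R) :
  open [set z : (R[i] : numFieldType) | complex.Re z < a].
Proof.
rewrite openE => z /= za; apply/nbhs_ballP.
exists (a - complex.Re z)%:C; first by rewrite /= ltcR subr_gt0.
move=> w; rewrite -ball_normE/= distrC => zw.
have := le_lt_trans (normc_ge_Re _) zw.
rewrite ltcR => /(le_lt_trans (ler_norm _)).
by case: w z {za zw} => [? ?] [? ?] /=; rewrite ltrD2r.
Qed.

Lemma open_Im_lt (a : R) :
  open [set z : (R[i] : numFieldType) | complex.Im z < a].
Proof.
rewrite openE => z /= za; apply/nbhs_ballP.
exists (a - complex.Im z)%:C; first by rewrite /= ltcR subr_gt0.
move=> w; rewrite -ball_normE/= distrC => zw.
have := le_lt_trans (normc_ge_Im _) zw.
rewrite ltcR => /(le_lt_trans (ler_norm _)).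
by case: w z {za zw} => [? ?] [? ?] /=; rewrite ltrD2r.
Qed.

Lemma measurable_Re : measurable_fun setT (fun z : borelC R => complex.Re z).
Proof.
apply: (measurability _ (RGenInftyO.measurableE R)) => _ [_ [a ->] <-].
rewrite setTI; apply: sub_sigma_algebra.
rewrite (_ : _ @^-1` _ = [set z : borelC R | complex.Re (z : R[i]) < a]).
  exact: open_Re_lt.
by apply/seteqP; split => z /=; rewrite in_itv.
Qed.

Lemma measurable_Im : measurable_fun setT (fun z : borelC R => complex.Im z).
Proof.
apply: (measurability _ (RGenInftyO.measurableE R)) => _ [_ [a ->] <-].
rewrite setTI; apply: sub_sigma_algebra.
rewrite (_ : _ @^-1` _ = [set z : borelC R | complex.Im (z : R[i]) < a]).
  exact: open_Im_lt.
by apply/seteqP; split => z /=; rewrite in_itv.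
Qed.

Lemma measurable_monomial i j :
  measurable_fun setT (fun z : borelC R => complex.Re (monomial i j z)) /\
  measurable_fun setT (fun z : borelC R => complex.Im (monomial i j z)).
Proof.
pose mc (f : borelC R -> R[i]) :=
  measurable_fun setT (fun z : borelC R => complex.Re (f z)) /\
  measurable_fun setT (fun z : borelC R => complex.Im (f z)).
have mcM f g : mc f -> mc g -> mc (fun z => f z * g z).
  move=> [fr fi] [gr gi]; split.
    rewrite (_ : (fun _ => _) = (fun z => complex.Re (f z) * complex.Re (g z) -
      complex.Im (f z) * complex.Im (g z))).
      by apply: measurable_funB; apply: measurable_funM.
    by apply/funext => z; case: (f z); case: (g z).
  rewrite (_ : (fun _ => _) = (fun z => complex.Re (f z) * complex.Im (g z) +
    complex.Im (f z) * complex.Re (g z))).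
    by apply: measurable_funD; apply: measurable_funM.
  by apply/funext => z; case: (f z); case: (g z).
have mcX f n : mc f -> mc (fun z => f z ^+ n).
  move=> mf; elim: n => [|n IH].
    by split; [exact: (measurable_cst (1 : R))|exact: (measurable_cst (0 : R))].
  by rewrite (funext (fun z => exprS (f z) n)); exact: mcM.
apply: mcM; apply: mcX; split; [exact: measurable_Re|exact: measurable_Im|..].
  rewrite (_ : (fun _ => _) = (fun z : borelC R => complex.Re (z : R[i]))).
    exact: measurable_Re.
  by apply/funext; case.
rewrite (_ : (fun _ => _) = (fun z : borelC R => - complex.Im (z : R[i]))).
  by apply: measurableT_comp => //; exact: measurable_Im.
by apply/funext; case.
Qed.

Lemma unit_circleP z : unit_circle R z <-> normsq z = 1.
Proof.
rewrite /unit_circle/=; split => [z1|z1].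
  by apply: complexI; rewrite normsqE z1 expr1n.
have /eqP : `|z| ^+ 2 = 1 by rewrite -normsqE z1.
by rewrite sqrp_eq1// => /eqP.
Qed.

Lemma normsq_circleX z k : unit_circle R z -> normsq (z ^+ k) = 1.
Proof.
by move=> z1; apply: complexI; rewrite normsqE normrX (z1 : `|z| = 1) !expr1n.
Qed.

Lemma normc_monomial i j (z : borelC R) :
  unit_circle R z -> `|monomial i j z| = 1.
Proof.
move=> z1; rewrite /monomial normrM !normrX normcJ (z1 : `|z : R[i]| = 1).
by rewrite !expr1n mulr1.
Qed.

Lemma measurable_unit_circle : measurable (unit_circle R).
Proof.
rewrite (_ : unit_circle R = [set z : borelC R |
  complex.Re z ^+ 2 + complex.Im z ^+ 2 \in [set 1 : R]]).
  rewrite -[X in measurable X]setTI.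
  have : measurable_fun setT
      (fun z : borelC R => complex.Re z ^+ 2 + complex.Im z ^+ 2).
    by apply: measurable_funD; apply: measurable_funX;
      [exact: measurable_Re|exact: measurable_Im].
  move=> /(_ measurableT _ (measurable_set1 1)).
  by congr measurable; apply/seteqP; split => z /=; rewrite inE.
by apply/seteqP; split => z /=; rewrite inE => /unit_circleP.
Qed.

Lemma measurable_expi :
  measurable_fun setT (@expi R : measurableTypeR R -> borelC R).
Proof.
apply: (@measurability _ _ _ (borelC R) _ _ (@open (R[i] : numFieldType))) =>
  //.
move=> _ [U oU <-]; rewrite setTI; apply: open_measurable.
rewrite openE => t /= Ut; have [r r0 rU] := open_box oU Ut.
have /cvgrPdist_lt/(_ _ r0) ct := @continuous_cos R t.
have /cvgrPdist_lt/(_ _ r0) st := @continuous_sin R t.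
near=> s; apply: rU => /=; rewrite distrC; near: s.
  exact: ct.
exact: st.
Unshelve. all: by end_near. Qed.

End ComplexBorel.

(** * Measures on the circle and orthonormality of the monomials *)

Section Concentrated.
Context {R : realType}.
Variable mu : {measure set (borelC R) -> \bar R}.
Hypothesis finmu : (mu setT < +oo)%E.
Local Notation D := (unit_circle R).

Let mD := @measurable_unit_circle R.

Lemma bounded_integrable (h : borelC R -> R) (C : R) : measurable_fun setT h ->
  (forall z, D z -> `|h z| <= C) -> mu.-integrable D (EFin \o h).
Proof.
move=> mh hC; apply: measurable_bounded_integrable => //.
- by apply: le_lt_trans finmu; apply: le_measure; rewrite ?inE.
- exact: measurable_funTS.
- exists C; split; rewrite ?num_real// => x Cx z Dz.
  by apply: le_trans (hC _ Dz) (ltW Cx).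
Qed.

Hypothesis supp : mu (~` D) = 0%E.

Lemma circle_integrable (h : borelC R -> R) (C : R) : measurable_fun setT h ->
  (forall z, D z -> `|h z| <= C) -> mu.-integrable setT (EFin \o h).
Proof.
move=> mh hC; apply/(negligible_integrable (measurableC mD)) => //.
  exact/measurable_EFinP.
by rewrite setDE setTI setCK; exact: bounded_integrable hC.
Qed.

Lemma Rintegral_circle (h : borelC R -> R) :
  mu.-integrable setT (EFin \o h) ->
  \int[mu]_z h z = \int[mu]_(z in D) h z.
Proof.
move=> ih; rewrite /Rintegral.
rewrite (negligible_integral (measurableC mD) measurableT ih supp).
by rewrite setDE setTI setCK.
Qed.

Lemma circle_finite_moments : finite_moments mu.
Proof.
move=> i j; have [mr mi] := measurable_monomial (R := R) i j.
split; apply: (@circle_integrable _ 1) => // z /(normc_monomial i j).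
  exact: normr_Re_le1.
exact: normr_Im_le1.
Qed.

End Concentrated.

Section Arc.
Context {R : realType}.
Local Notation D := (unit_circle R).

HB.instance Definition _ := Measure.copy (arc_measure R)
  (measure_function_pushforward__canonical__measure_function_Measure
    (uniform_prob (@lt0_2pi R)) (@measurable_expi R)).

Definition arc : {measure set (borelC R) -> \bar R} := arc_measure R.

Lemma expi_circle (t : R) : D (expi t).
Proof. by apply/unit_circleP; rewrite /normsq/= cos2Dsin2. Qed.

Lemma arc_setT : arc setT = 1%E.
Proof.
by rewrite /arc/= /arc_measure /pushforward preimage_setT probability_setT.
Qed.

Lemma arc_setC_circle : arc (~` D) = 0%E.
Proof.
rewrite /arc/= /arc_measure /pushforward (_ : _ @^-1` _ = set0) ?measure0//.
by apply/seteqP; split => t //=; apply; exact: expi_circle.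
Qed.

Lemma arc_circle : arc D = 1%E.
Proof.
rewrite -arc_setT -(setUv D) measureU0//; last exact: arc_setC_circle.
- exact: measurable_unit_circle.
- exact: measurableC measurable_unit_circle.
Qed.

Lemma arc_finite_moments : finite_moments arc.
Proof.
apply: circle_finite_moments; first by rewrite arc_setT ltry.
exact: arc_setC_circle.
Qed.

(** The uniform law on [0, 2 pi] integrates nonnegative functions through the
    Lebesgue integral, so the fundamental theorem of calculus is applied to
    [1 + f], which has primitive [t + F t]. *)
Lemma integral_arc_periodic (h : borelC R -> R) (F f : R -> R) :
  measurable_fun setT h -> (forall z, D z -> `|h z| <= 1) ->
  (forall t, h (expi t) = f t) -> continuous f ->
  (forall t : R, is_derive t (1 : R) F (f t)) -> F (2 * pi) = F 0 ->
  \int[arc]_z h z = 0.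
Proof.
move=> mh h1 hf cf dF F0.
have ih : arc.-integrable setT (EFin \o h).
  apply: circle_integrable h1 => //; first by rewrite arc_setT ltry.
  exact: arc_setC_circle.
have mD := @measurable_unit_circle R.
rewrite (Rintegral_circle arc_setC_circle)//.
have i1 : arc.-integrable D (EFin \o cst 1).
  apply: (@bounded_integrable _ _ _ _ 1) => //; first by rewrite arc_setT ltry.
  by move=> z _; rewrite normr1.
suff : \int[arc]_(z in D) (1 + h z) = 1.
  rewrite RintegralD//; last exact: integrableS ih.
  rewrite Rintegral_cst//= arc_circle mul1r => /eqP.
  by rewrite -subr_eq0 addrC addKr => /eqP.
have h1_ge0 z : D z -> 0 <= 1 + h z.
  by move=> /h1; rewrite ler_norml => /andP[]; rewrite -lerBlDl sub0r.
rewrite /Rintegral /arc/= /arc_measure.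
rewrite ge0_integral_pushforward//=; last 2 first.
- by apply/measurable_funTS/measurable_EFinP; exact: measurable_funD.
- by move=> z /set_mem Dz; rewrite lee_fin h1_ge0.
have -> : @expi R @^-1` D = setT.
  by apply/seteqP; split => t // _; exact: expi_circle.
rewrite integral_uniform; last 2 first.
- apply/measurable_EFinP; apply: measurable_funD => //.
  by apply: (measurableT_comp mh); exact: measurable_expi.
- by move=> t; rewrite lee_fin h1_ge0//; exact: expi_circle.
have dG (t : R) : is_derive t (1 : R) (fun t => t + F t) (1 + f t).
  exact: is_deriveD.
rewrite subr0; under eq_integral do rewrite hf.
rewrite (@continuous_FTC2 _ (fun t => 1 + f t) (fun t => t + F t))//.
- rewrite add0r F0 -EFinB addrK -EFinM/=.
  by rewrite mulVf// gt_eqF// lt0_2pi.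
- exact: lt0_2pi.
- have c1f : continuous (fun t => 1 + f t).
    by move=> t; apply: cvgD; [exact: cvg_cst|exact: cf].
  exact: continuous_subspaceT.
- have cG (t : R) : {for t, continuous (fun t => t + F t)}.
    by apply/differentiable_continuous/derivable1_diffP; case: (dG t).
  split; [by move=> t _; case: (dG t)|exact: cvg_at_right_filter (cG _)|].
  exact: cvg_at_left_filter (cG _).
- by move=> t _; rewrite derive1E; case: (dG t).
- exact: measurable_expi.
Qed.

Lemma expiD (s t : R) :
  (expi (s + t) : R[i]) = (expi s : R[i]) * (expi t : R[i]).
Proof.
by apply/eqP; rewrite eq_complex/= cosD sinD eqxx/= addrC (mulrC (sin s)) eqxx.
Qed.

Lemma expiX (t : R) n : (expi t : R[i]) ^+ n = expi (n%:R * t).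
Proof.
elim: n => [|n IH]; first by rewrite mul0r expr0 /expi cos0 sin0.
by rewrite exprS IH -expiD -nat1r mulrDl mul1r.
Qed.

Lemma conjc_expi (t : R) : ((expi t : R[i])^*)%R = (expi (- t) : R[i]).
Proof. by rewrite /expi cosN sinN. Qed.

Lemma monomial_expi i j (t : R) :
  monomial i j (expi t) = expi ((i%:R - j%:R) * t).
Proof.
by rewrite /monomial conjc_expi !expiX -expiD mulrN -mulNr -mulrDl.
Qed.

Lemma expi2pi n : expi (n%:R * (2 * pi)) = (1 : R[i]) :> R[i].
Proof. by rewrite -expiX /expi mulr_natl cos2pi sin2pi expr1n. Qed.

Lemma moment_matrix_arc i j : moment_matrix arc i j = (i == j)%:R.
Proof.
rewrite /moment_matrix; have [->|ij] := eqVneq i j.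
  have [ir ii] := arc_finite_moments j j.
  have m1 (z : borelC R) : D z -> monomial j j z = 1.
    move=> /unit_circleP z1; rewrite /monomial -exprMn -sqr_normc -normsqE z1.
    by rewrite expr1n.
  rewrite /cintegral !(Rintegral_circle arc_setC_circle)//.
  rewrite (@eq_Rintegral _ _ _ _ _ (cst 1)); last by move=> z /set_mem /m1 ->.
  rewrite [X in _ +i* X](@eq_Rintegral _ _ _ _ _ (cst 0)); last first.
    by move=> z /set_mem /m1 ->.
  rewrite !Rintegral_cst//= ?arc_circle ?mul0r ?mulr1//;
    exact: measurable_unit_circle.
set c : R := i%:R - j%:R.
have c0 : c != 0 by rewrite subr_eq0 eqr_nat.
have [mr mi] := measurable_monomial (R := R) i j.
have c2pi : expi (c * (2 * pi)) = (1 : R[i]) :> R[i].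
  by rewrite mulrBl expiD expi2pi mul1r -conjc_expi expi2pi rmorph1.
have [cc sc] : cos (c * (2 * pi)) = 1 /\ sin (c * (2 * pi)) = 0 by case: c2pi.
apply/eqP; rewrite eq_complex/=; apply/andP; split; apply/eqP.
- apply: (@integral_arc_periodic _
    (fun t => c^-1 * sin (c * t)) (fun t => cos (c * t))) => //.
  + by move=> z /(normc_monomial i j); exact: normr_Re_le1.
  + by move=> t; rewrite monomial_expi.
  + move=> t; apply: continuous_comp; first exact: mulrl_continuous.
    exact: continuous_cos.
  + move=> t.
    have cd : is_derive t (1 : R) ( *%R c) (c *: (1 : R)).
      exact: is_deriveZ.
    have := is_deriveZ c^-1 (is_derive1_comp (is_derive_sin (c * t)) cd).
    by rewrite -[c^-1 *: _]/(c^-1 * (_ * (c * 1))) mulr1 mulrCA mulVf// mulr1.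
  + by rewrite sc !mulr0 sin0 mulr0.
- apply: (@integral_arc_periodic _
    (fun t => - c^-1 * cos (c * t)) (fun t => sin (c * t))) => //.
  + by move=> z /(normc_monomial i j); exact: normr_Im_le1.
  + by move=> t; rewrite monomial_expi.
  + move=> t; apply: continuous_comp; first exact: mulrl_continuous.
    exact: continuous_sin.
  + move=> t.
    have cd : is_derive t (1 : R) ( *%R c) (c *: (1 : R)).
      exact: is_deriveZ.
    have := is_deriveZ (- c^-1) (is_derive1_comp (is_derive_cos (c * t)) cd).
    rewrite -[- c^-1 *: _]/(- c^-1 * (- _ * (c * 1))) mulr1 !mulNr mulrN opprK.
    by rewrite mulrCA mulVf// mulr1.
  + by rewrite cc mulr0 cos0.
Qed.

Lemma moment_trunc_arc n : moment_trunc arc n = 1%:M.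
Proof. by apply/matrixP => i j; rewrite !mxE moment_matrix_arc. Qed.

End Arc.

(** * Polynomials approximating a step function *)

Section StepPolynomials.
Context {R : realType}.
Implicit Types (s t : R) (n : nat).

Lemma bernoulli_ineq s n : -1 <= s -> 1 + n%:R * s <= (1 + s) ^+ n.
Proof.
move=> s1; elim: n => [|n IH]; first by rewrite mul0r addr0 expr0.
have n0 : 0 <= n%:R :> R by [].
rewrite exprS -nat1r; apply: (@le_trans _ _ ((1 + s) * (1 + n%:R * s))).
  by have := mulr_ge0 n0 (sqr_ge0 s); lra.
by rewrite ler_wpM2l//; lra.
Qed.

(** Polynomials converging on [0, 1] to the indicator of t < 1/2. The factor
    [n] in the exponent decides the limit at 1/2: with the exponent [2 ^ n]
    alone it would be exp(-1) instead of 0. *)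
Definition step n t : R := (1 - t ^+ n) ^+ (n * 2 ^ n).

Lemma step_itv n t : 0 <= t <= 1 -> 0 <= step n t <= 1.
Proof.
move=> /andP[t0 t1]; have tn0 := exprn_ge0 n t0.
have tn1 : t ^+ n <= 1 by rewrite exprn_ile1.
by rewrite exprn_ge0 ?exprn_ile1; lra.
Qed.

Lemma cvg_natM_expr (u : R) : 0 <= u < 1 ->
  (n%:R * u ^+ n) @[n --> \oo] --> (0 : R).
Proof.
move=> /andP[u0 u1].
(* as u <= v ^ 2, n * u ^ n <= (n * v ^ n) * v ^ n with n * v ^ n bounded *)
pose v := (1 + u) / 2.
have v0 : 0 <= v by rewrite /v; lra.
have v1 : v < 1 by rewrite /v; lra.
have uv : u <= v ^+ 2.
  by have := sqr_ge0 (1 - u); rewrite /v; lra.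
have nv n : n%:R * v ^+ n * (1 - v) <= 1 - v ^+ n.
  elim: n => [|n IH]; first by rewrite !mul0r expr0 subrr.
  rewrite exprS -nat1r.
  have vn0 := exprn_ge0 n v0.
  have : 0 <= (1 + n%:R) * v ^+ n * (1 - v) * (1 - v).
    by rewrite !mulr_ge0//; lra.
  by move: IH; move: (v ^+ n) (n%:R : R) vn0 => x y vn0 IH H; nra.
have lim : ((1 - v)^-1 * v ^+ n) @[n --> \oo] --> (0 : R).
  rewrite -(mulr0 (1 - v)^-1); apply: cvgMr.
  by apply: cvg_expr; rewrite ger0_norm.
apply: (@squeeze_cvgr _ _ _ _ (cst 0) (fun n => (1 - v)^-1 * v ^+ n)) lim;
  last first.
  exact: cvg_cst.
apply: nearW => n /=; rewrite mulr_ge0 ?exprn_ge0//=.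
have w : 0 < 1 - v by lra.
rewrite ler_pdivlMl//.
apply: (@le_trans _ _ ((1 - v) * (n%:R * v ^+ n * v ^+ n))).
  rewrite ler_wpM2l//; first exact: ltW.
  rewrite -mulrA ler_wpM2l// -exprD addnn -mul2n exprM.
  by rewrite lerXn2r// ?nnegrE// exprn_ge0.
rewrite mulrA ler_piMl ?exprn_ge0// mulrC; apply: le_trans (nv n) _.
by rewrite gerBl exprn_ge0.
Qed.

Lemma cvg_step t : 0 <= t <= 1 ->
  step n t @[n --> \oo] --> ((t < 2^-1)%R%:R : R).
Proof.
move=> t01; have /andP[t0 t1] := t01.
have ksE n : (n * 2 ^ n)%:R * t ^+ n = n%:R * (2 * t) ^+ n.
  by rewrite natrM natrX exprMn mulrA.
have s0 n : 0 <= t ^+ n by exact: exprn_ge0.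
have [tlt|tge] := ltP t 2^-1.
(* below the threshold, (1 - s) ^ k >= 1 - k s *)
- have lim : (1 - n%:R * (2 * t) ^+ n) @[n --> \oo] --> (1 : R).
    rewrite -[X in _ --> X]subr0; apply: cvgB; first exact: cvg_cst.
    by apply: cvg_natM_expr; lra.
  apply: (@squeeze_cvgr _ _ _ _
    (fun n => 1 - n%:R * (2 * t) ^+ n) (cst 1)) lim _.
    apply: nearW => n /=; have /andP[_ ->] := step_itv n t01; rewrite andbT.
    rewrite -ksE -mulrN; apply: bernoulli_ineq.
    by rewrite lerN2 exprn_ile1.
  exact: cvg_cst.
(* above it, (1 - s) ^ k <= (1 + s) ^ - k <= (1 + k s) ^ - 1 *)
- apply: (@squeeze_cvgr _ _ _ _ (cst 0) harmonic);
    [|exact: cvg_cst|exact: cvg_harmonic].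
  apply: nearW => n /=; have /andP[-> _] := step_itv n t01 => /=.
  have n1 : n.+1%:R <= (1 + t ^+ n) ^+ (n * 2 ^ n).
    apply: le_trans (bernoulli_ineq _ _); last by apply: le_trans (s0 n); lra.
    rewrite ksE -nat1r lerD2l ler_peMr// exprn_ege1//; lra.
  rewrite -[leRHS]mul1r ler_pdivlMr//.
  apply: (@le_trans _ _ (step n t * (1 + t ^+ n) ^+ (n * 2 ^ n))).
    by rewrite ler_wpM2l//; case/andP: (step_itv n t01).
  rewrite -exprMn exprn_ile1//; last by have := sqr_ge0 (t ^+ n); lra.
  by rewrite mulr_ge0//; [rewrite subr_ge0 exprn_ile1|rewrite addr_ge0].
Qed.

End StepPolynomials.

(** * Trigonometric polynomials *)

Section TrigPolynomials.
Context {R : realType}.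
Local Notation D := (unit_circle R).
Implicit Types f g : borelC R -> R.

(** On the circle [z^-1] is the conjugate of [z], so a trigonometric polynomial
    is a function that becomes a polynomial after multiplication by a power of
    [z]. That power has modulus 1, which is why such a function can be traded
    for a polynomial inside the energy. *)
Definition trigpoly g := measurable_fun setT g /\
  exists k (Q : {poly R[i]}), forall z : borelC R, D z ->
    (z : R[i]) ^+ k * (g z)%:C = Q.[z : R[i]].

Lemma trigpoly_cst (c : R) : trigpoly (cst c).
Proof.
by split=> //; exists 0%N, (c%:C)%:P => z _; rewrite expr0 mul1r hornerC.
Qed.

Lemma trigpolyM f g : trigpoly f -> trigpoly g -> trigpoly (fun z => f z * g z).
Proof.
move=> [mf [k [P fP]]] [mg [l [Q gQ]]]; split; first exact: measurable_funM.
exists (k + l)%N, (P * Q) => z Dz.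
by rewrite hornerM -fP// -gQ// exprD rmorphM/= mulrACA.
Qed.

Lemma trigpolyD f g : trigpoly f -> trigpoly g -> trigpoly (fun z => f z + g z).
Proof.
move=> [mf [k [P fP]]] [mg [l [Q gQ]]]; split; first exact: measurable_funD.
exists (k + l)%N, ('X^l * P + 'X^k * Q) => z Dz.
rewrite hornerD !hornerM !hornerXn -fP// -gQ// exprD rmorphD/=.
by ring.
Qed.

Lemma trigpolyX f n : trigpoly f -> trigpoly (fun z => f z ^+ n).
Proof.
move=> tf; elim: n => [|n IH]; first exact: trigpoly_cst.
by rewrite (funext (fun z => exprS (f z) n)); exact: trigpolyM.
Qed.

Lemma trigpolyB f g : trigpoly f -> trigpoly g -> trigpoly (fun z => f z - g z).
Proof.
move=> tf tg; rewrite (_ : (fun _ => _) = (fun z => f z + (-1) * g z)).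
  by apply: trigpolyD => //; apply: trigpolyM => //; exact: trigpoly_cst.
by apply/funext => z; rewrite mulN1r.
Qed.

Lemma trigpoly_Re : trigpoly (fun z : borelC R => complex.Re (z : R[i])).
Proof.
split; first exact: measurable_Re.
exists 1%N, (2^-1 *: ('X^2 + 1)) => z /unit_circleP z1.
rewrite hornerZ hornerD hornerXn hornerC expr1.
have e : z * z^*%C = 1 by rewrite -sqr_normc -normsqE z1.
by rewrite ReJ_add mulrA mulrDr e; ring.
Qed.

Lemma trigpoly_Im : trigpoly (fun z : borelC R => complex.Im (z : R[i])).
Proof.
split; first exact: measurable_Im.
exists 1%N, ((2^-1 * 'i%C) *: (1 - 'X^2)) => z /unit_circleP z1.
rewrite hornerZ hornerD hornerN hornerXn hornerC expr1.
have e : z * z^*%C = 1 by rewrite -sqr_normc -normsqE z1.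
by rewrite ImJ_sub !mulrA mulrBr e; ring.
Qed.

Lemma normsq_horner_bounded (Q : {poly R[i]}) :
  exists C : R, forall z, D z -> normsq Q.[z : R[i]] <= C.
Proof.
pose B : R[i] := \sum_(i < size Q) `|Q`_i|.
have B0 : 0 <= B by exact: sumr_ge0.
exists (complex.Re (B ^+ 2)) => z Dz.
rewrite -lecR normsqE RRe_real ?realX ?ger0_real//.
rewrite lerXn2r ?nnegrE// horner_coef; apply: le_trans (ler_norm_sum _ _ _) _.
apply: ler_sum => i _.
by rewrite normrM normrX (Dz : `|z : R[i]| = 1) expr1n mulr1.
Qed.

Lemma trigpoly_bounded g : trigpoly g ->
  exists C : R, forall z, D z -> g z ^+ 2 <= C.
Proof.
move=> [_ [k [Q gQ]]]; have [C QC] := normsq_horner_bounded Q.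
exists C => z Dz; apply: le_trans (QC z Dz); rewrite -gQ// normsqM normsq_real.
by rewrite normsq_circleX// mul1r.
Qed.

End TrigPolynomials.

(** * Density of the trigonometric polynomials in mean square *)

Section Density.
Context {R : realType}.
Local Notation D := (unit_circle R).
Variable mu : {measure set (borelC R) -> \bar R}.
Hypothesis finmu : (mu setT < +oo)%E.
Implicit Types f g h : borelC R -> R.

Let mD : measurable D := @measurable_unit_circle R.

Definition sqbounded f := measurable_fun setT f /\
  exists C : R, forall z, D z -> f z ^+ 2 <= C.

Lemma trigpoly_sqbounded g : trigpoly g -> sqbounded g.
Proof. by move=> tg; split; [case: tg|exact: trigpoly_bounded]. Qed.

Lemma sqboundedB f g :
  sqbounded f -> sqbounded g -> sqbounded (fun z => f z - g z).
Proof.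
move=> [mf [A fA]] [mg [B gB]]; split; first exact: measurable_funB.
exists (2 * A + 2 * B) => z Dz.
by have := fA z Dz; have := gB z Dz; have := sqr_ge0 (f z + g z); lra.
Qed.

Lemma sqbounded_integrable f : sqbounded f ->
  mu.-integrable D (EFin \o (fun z => f z ^+ 2)).
Proof.
move=> [mf [C fC]]; apply: (bounded_integrable finmu (C := C)).
  exact: measurable_funX.
by move=> z Dz; rewrite ger0_norm ?sqr_ge0 ?fC.
Qed.

Definition sqdist f g := \int[mu]_(z in D) (f z - g z) ^+ 2.

Lemma sqdist_triangle f g h : sqbounded f -> sqbounded g -> sqbounded h ->
  sqdist f h <= 2 * sqdist f g + 2 * sqdist g h.
Proof.
move=> bf bg bh.
have I2 (k : borelC R -> R) : sqbounded k ->
    mu.-integrable D (EFin \o (fun z => 2 * k z ^+ 2)).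
  by move=> /sqbounded_integrable; exact: integrable_scale.
have ifg := I2 _ (sqboundedB bf bg); have igh := I2 _ (sqboundedB bg bh).
rewrite /sqdist -!RintegralZl//; try exact/sqbounded_integrable/sqboundedB.
rewrite -RintegralD//; apply: le_Rintegral => //.
- exact/sqbounded_integrable/sqboundedB.
- exact: integrable_add.
- by move=> z _; have := sqr_ge0 ((f z - g z) - (g z - h z)); lra.
Qed.

Definition approximable f := sqbounded f /\
  forall e, 0 < e -> exists2 g, trigpoly g & sqdist f g < e.

Lemma sqdist_self f : sqdist f f = 0.
Proof.
rewrite /sqdist (@eq_Rintegral _ _ _ _ _ (cst 0)) ?Rintegral_cst ?mul0r//.
by move=> z _; rewrite subrr expr0n.
Qed.

Lemma trigpoly_approximable g : trigpoly g -> approximable g.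
Proof.
move=> tg; split; first exact: trigpoly_sqbounded.
by move=> e e0; exists g => //; rewrite sqdist_self.
Qed.

Lemma approximableB f1 f2 : approximable f1 -> approximable f2 ->
  approximable (fun z => f1 z - f2 z).
Proof.
move=> [b1 a1] [b2 a2]; split; first exact: sqboundedB.
move=> e e0; have e4 : 0 < e / 4 by lra.
have [g1 t1 d1] := a1 _ e4; have [g2 t2 d2] := a2 _ e4.
exists (fun z => g1 z - g2 z); first exact: trigpolyB.
have c1 := trigpoly_sqbounded t1; have c2 := trigpoly_sqbounded t2.
apply: le_lt_trans (sqdist_triangle (sqboundedB b1 b2) (sqboundedB c1 b2)
  (sqboundedB c1 c2)) _.
have -> : sqdist (fun z => f1 z - f2 z) (fun z => g1 z - f2 z) = sqdist f1 g1.
  by apply: eq_Rintegral => z _; congr (_ ^+ 2); lra.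
have -> : sqdist (fun z => g1 z - f2 z) (fun z => g1 z - g2 z) = sqdist f2 g2.
  by apply: eq_Rintegral => z _; rewrite -[RHS]sqrrN; congr (_ ^+ 2); lra.
by lra.
Qed.

Lemma approximable_lim (f_ : nat -> borelC R -> R) f :
  (forall n, approximable (f_ n)) -> measurable_fun setT f ->
  (forall n z, D z -> 0 <= f_ n z <= 1) ->
  (forall z, D z -> f_ n z @[n --> \oo] --> f z) -> approximable f.
Proof.
move=> af mf f01 cf.
have g01 z : D z -> 0 <= f z <= 1.
  move=> Dz; apply/andP; split.
    apply: (cvgr_to_ge (cf z Dz)).
    by apply: nearW => n; case/andP: (f01 n z Dz).
  apply: (cvgr_to_le (cf z Dz)).
  by apply: nearW => n; case/andP: (f01 n z Dz).
have bf : sqbounded f.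
  split=> //; exists 1 => z /g01/andP[? ?]; exact: exprn_ile1.
split=> // e e0; have e4 : 0 < e / 4 by lra.
have i1 : mu.-integrable D (fun z => (cst 1 z ^+ 2)%:E).
  apply: sqbounded_integrable; split => //; exists 1 => z _.
  by rewrite /= expr1n.
have : sqdist f (f_ n) @[n --> \oo] --> (0 : R).
  apply: fine_cvg.
  have [] // := @dominated_convergence _ _ _ mu D mD
    (fun n z => ((f z - f_ n z) ^+ 2)%:E) (cst 0%E)
    (fun z => (cst 1 z ^+ 2)%:E).
  - move=> n; apply/measurable_funTS/measurable_EFinP/measurable_funX.
    by apply: measurable_funB => //; case: (af n) => [[]].
  - apply: aeW => z Dz; apply: cvg_EFin; first exact: nearW.
    rewrite [X in _ --> X](_ : _ = (f z - f z) * (f z - f z)); last first.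
      by rewrite subrr mul0r.
    have H : f z - f_ n z @[n --> \oo] --> f z - f z.
      by apply: cvgB; [exact: cvg_cst|exact: cf].
    exact: cvgM.
  - apply: aeW => z n Dz; rewrite lee_fin ger0_norm ?sqr_ge0//= expr1n.
    have := f01 n z Dz; have := g01 z Dz; nra.
  - by rewrite integral_cst// mul0e.
move=> /cvgrPdist_lt/(_ _ e4)[N _ /(_ N (leqnn N))].
rewrite sub0r normrN => dN.
have [[bN _] aN] := af N; have [g tg dg] := aN _ e4.
exists g => //; have tb := trigpoly_sqbounded tg.
apply: le_lt_trans (sqdist_triangle bf (af N).1 tb) _.
by have := ler_norm (sqdist f (f_ N)); lra.
Qed.

End Density.

Section BorelApproximation.
Context {R : realType}.
Local Notation D := (unit_circle R).

Definition quadrant (a b : R) : set (borelC R) :=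
  [set z | complex.Re (z : R[i]) < a /\ complex.Im (z : R[i]) < b].

Definition quadrants : set_system (borelC R) :=
  [set A | exists a b, A = quadrant a b].

Lemma quadrants_setI : setI_closed quadrants.
Proof.
move=> _ _ [a [b ->]] [c [d ->]]; exists (Num.min a c), (Num.min b d).
apply/seteqP; split => z /=; rewrite /quadrant/= !lt_min.
  by move=> [[-> ->] [-> ->]].
by move=> [/andP[-> ->] /andP[-> ->]].
Qed.

Lemma measurable_quadrant a b : measurable (quadrant a b).
Proof.
apply: measurableI; apply: sub_sigma_algebra;
  [exact: open_Re_lt|exact: open_Im_lt].
Qed.

(** An open set is the union of the half-open boxes with rational vertices that
    it contains, and such a box is a difference of quadrants. *)
Lemma borel_quadrants (A : set (borelC R)) : measurable A -> <<s quadrants >> A.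
Proof.
apply: smallest_sub; first exact: smallest_sigma_algebra.
move=> U oU.
pose Q : Type := g_sigma_algebraType quadrants.
pose box (q : rat * rat * (rat * rat)) : set Q :=
  (quadrant (ratr q.1.2) (ratr q.2.2) `\` quadrant (ratr q.1.1) (ratr q.2.2))
  `\` quadrant (ratr q.1.2) (ratr q.2.1).
have mbox q : measurable (box q).
  have mq a b : measurable (quadrant a b : set Q).
    by apply: sub_sigma_algebra; exists a, b.
  by apply: measurableD; [apply: measurableD|]; exact: mq.
suff -> : U = \bigcup_(q in [set q | box q `<=` U]) box q.
  have : measurable (\bigcup_(q in [set q | box q `<=` U]) box q).
    rewrite bigcup_mkcond; apply: countable_bigcupT_measurable => // q.
    by case: ifP => // _; exact: mbox.
  by [].
apply/seteqP; split => [z Uz|z [q qU /qU]//].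
have [r r0 rU] := open_box oU Uz.
have rat_near (x : R) : exists q1 q2 : rat,
    [/\ x - r < ratr q1, ratr q1 < x, x < ratr q2 & ratr q2 < x + r].
  have [|q1] := @rat_in_itvoo R (x - r) x; first by lra.
  have [|q2] := @rat_in_itvoo R x (x + r); first by lra.
  by rewrite !in_itv/= => /andP[? ?] /andP[? ?]; exists q1, q2.
have [a [b [za az zb bz]]] := rat_near (complex.Re (z : R[i])).
have [c [d [zc cz zd dz]]] := rat_near (complex.Im (z : R[i])).
exists ((a, b), (c, d)).
  move=> w /= [[[/= wb wd] wa] wc]; apply: rU.
    have {}wa : ratr a <= complex.Re (w : R[i]).
      by rewrite leNgt; apply/negP => wa'; exact: wa.
    by rewrite ltr_norml; apply/andP; split; lra.
  have {}wc : ratr c <= complex.Im (w : R[i]).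
    by rewrite leNgt; apply/negP => wc'; exact: wc.
  by rewrite ltr_norml; apply/andP; split; lra.
split=> /=; first split=> //.
  by move=> [/= + _]; rewrite ltNge (ltW az).
by move=> [/= _ +]; rewrite ltNge (ltW cz).
Qed.

(** A threshold of a trigonometric polynomial is a pointwise limit of
    polynomials in it, hence of trigonometric polynomials. *)
Lemma trigpoly_threshold (x : borelC R -> R) (a : R) :
  trigpoly x -> (forall z, D z -> `|x z| <= 1) ->
  exists f_ : nat -> borelC R -> R, [/\ forall n, trigpoly (f_ n),
    forall n z, D z -> 0 <= f_ n z <= 1 &
    forall z, D z -> f_ n z @[n --> \oo] --> ((x z < a)%R%:R : R)].
Proof.
move=> tx x1.
have a0 := normr_ge0 a.
(* rescaled so as to take values in [0, 1] on the circle, with threshold 1/2 *)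
pose t z := 2^-1 + (x z - a) * (2 * (1 + `|a|))^-1.
have b0 : 0 < 2 * (1 + `|a|) by lra.
have t01 z : D z -> 0 <= t z <= 1.
  move=> /x1; rewrite ler_norml => /andP[xl xu].
  have := ler_norm a; have := ler_norm (- a); rewrite normrN => al au.
  have e : - 2^-1 <= (x z - a) / (2 * (1 + `|a|)) <= 2^-1.
    by rewrite ler_pdivlMr// ler_pdivrMr//; apply/andP; split; lra.
  by rewrite /t; lra.
have tt : trigpoly t.
  apply: trigpolyD; first exact: trigpoly_cst.
  apply: trigpolyM; last exact: trigpoly_cst.
  by apply: trigpolyB => //; exact: trigpoly_cst.
exists (fun n z => step n (t z)); split.
- move=> n; apply: trigpolyX; apply: trigpolyB; first exact: trigpoly_cst.
  exact: trigpolyX.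
- by move=> n z /t01; exact: step_itv.
- move=> z /t01 tz; have := cvg_step tz.
  by rewrite /t gtrDl pmulr_llt0 ?invr_gt0// subr_lt0.
Qed.

Variable mu : {measure set (borelC R) -> \bar R}.
Hypothesis finmu : (mu setT < +oo)%E.

Lemma quadrant_approximable a b : approximable mu \1_(quadrant a b).
Proof.
have re1 z : D z -> `|complex.Re (z : R[i])| <= 1 by exact: normr_Re_le1.
have im1 z : D z -> `|complex.Im (z : R[i])| <= 1 by exact: normr_Im_le1.
have [f [tf f01 fcv]] := trigpoly_threshold a trigpoly_Re re1.
have [g [tg g01 gcv]] := trigpoly_threshold b trigpoly_Im im1.
apply: (approximable_lim finmu (f_ := fun n z => f n z * g n z)).
- by move=> n; apply: trigpoly_approximable; exact: trigpolyM.
- by apply: measurable_indic; exact: measurable_quadrant.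
- move=> n z Dz.
  have /andP[f0 f1] := f01 n z Dz; have /andP[g0 g1] := g01 n z Dz.
  by rewrite mulr_ge0//= mulr_ile1.
- move=> z Dz; rewrite (_ : \1_(quadrant a b) z =
    (complex.Re (z : R[i]) < a)%R%:R * (complex.Im (z : R[i]) < b)%R%:R).
    by apply: cvgM; [exact: fcv|exact: gcv].
  rewrite indicE -natrM mulnb; congr (nat_of_bool _)%:R; apply/idP/idP.
    by rewrite inE => -[-> ->].
  by move=> /andP[za zb]; rewrite inE.
Qed.

(** The sets whose indicator is approximable form a lambda-system, and the
    quadrants form a pi-system that generates the Borel sets. *)
Lemma indic_approximable (A : set (borelC R)) :
  measurable A -> approximable mu \1_A.
Proof.
move=> mA.
suff : [set B | measurable B /\ approximable mu (\1_B : borelC R -> R)] A.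
  by case.
apply: (lambda_system_subset quadrants_setI _ _ _ (borel_quadrants mA)) => //.
- split=> //.
  + split=> //; rewrite indicT; apply: trigpoly_approximable.
    exact: trigpoly_cst.
  + move=> B C CB [mB aB] [mC aC]; split; first exact: measurableD.
    rewrite (_ : \1_(B `\` C) = fun z => \1_B z - \1_C z).
      exact: approximableB.
    apply/funext => z; rewrite !indicE in_setD.
    have [zC|zC] := boolP (z \in C); last by rewrite andbT subr0.
    by rewrite andbF (_ : z \in B) ?subrr// inE; apply: CB; rewrite inE in zC.
  + move=> F ndF aF; have mF : measurable (\bigcup_i F i).
      by apply: bigcupT_measurable => i; case: (aF i).
    split=> //; apply: (approximable_lim finmu (f_ := fun n => \1_(F n))).
    * by move=> n; case: (aF n).
    * exact: measurable_indic.
    * by move=> n z _; rewrite indicE; case: (_ \in _); rewrite /= ?lexx ler01.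
    * move=> z _; have [[k _ Fkz]|nF] := pselect ((\bigcup_i F i) z).
        rewrite [in X in _ --> X]indicE mem_set; last by exists k.
        apply: cvg_near_cst; exists k => // n /= kn.
        by rewrite indicE mem_set//; apply: (subsetPset _ _ (ndF _ _ kn)).
      rewrite [in X in _ --> X]indicE memNset//.
      apply: cvg_near_cst; apply: nearW => n.
      by rewrite indicE memNset// => Fnz; apply: nF; exists n.
- move=> _ [a [b ->]]; split; [exact: measurable_quadrant|].
  exact: quadrant_approximable.
Qed.

End BorelApproximation.

(** * Localising the energy of a polynomial *)

Section Perturbation.
Context {R : realType}.
Local Notation D := (unit_circle R).
Implicit Types (mu : {measure set (borelC R) -> \bar R}).
Implicit Types h f g : borelC R -> R.

Let mD : measurable D := @measurable_unit_circle R.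

Lemma Rintegral_le_measure mu1 mu2 h (C : R) :
  (forall A, measurable A -> (mu1 A <= mu2 A)%E) -> (mu2 setT < +oo)%E ->
  measurable_fun setT h ->
  (forall z, 0 <= h z) -> (forall z, D z -> h z <= C) ->
  \int[mu1]_(z in D) h z <= \int[mu2]_(z in D) h z.
Proof.
move=> mu12 fin2 mh h0 hC.
have fin1 : (mu1 setT < +oo)%E by apply: le_lt_trans fin2; exact: mu12.
have hC' z : D z -> `|h z| <= C by move=> Dz; rewrite ger0_norm// hC.
rewrite /Rintegral fine_le//.
- exact: integrable_fin_num (bounded_integrable fin1 mh hC').
- exact: integrable_fin_num (bounded_integrable fin2 mh hC').
- by apply: ge0_le_measure_integral => //; exact/measurable_EFinP.
Qed.

Lemma Rintegral_eq_ae mu (N : set (borelC R)) h1 h2 :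
  measurable N -> mu N = 0%E ->
  measurable_fun setT h1 -> measurable_fun setT h2 ->
  (forall z, D z -> ~ N z -> h1 z = h2 z) ->
  \int[mu]_(z in D) h1 z = \int[mu]_(z in D) h2 z.
Proof.
move=> mN N0 m1 m2 h12; congr fine; apply: ae_eq_integral => //.
- exact/measurable_funTS/measurable_EFinP.
- exact/measurable_funTS/measurable_EFinP.
- exists N; split=> // z /= nz; apply: contrapT => Nz; apply: nz => Dz.
  by rewrite h12.
Qed.

(** From (a + b)^2 <= (1 + e) a^2 + (1 + 1/e) b^2 with a = g and b = f - g. *)
Lemma weighted_sq_le mu (w : borelC R -> R) (C e : R) f g : (mu setT < +oo)%E ->
  measurable_fun setT w -> (forall z, D z -> 0 <= w z <= C) -> 0 < e ->
  sqbounded f -> sqbounded g ->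
  \int[mu]_(z in D) (f z ^+ 2 * w z) <=
  (1 + e) * \int[mu]_(z in D) (g z ^+ 2 * w z) + (1 + e^-1) * C * sqdist mu f g.
Proof.
move=> finmu mw wC e0 bf bg.
have iw h : sqbounded h -> mu.-integrable D (EFin \o (fun z => h z ^+ 2 * w z)).
  move=> [mh [B hB]]; apply: (bounded_integrable finmu (C := B * C)).
    by apply: measurable_funM => //; exact: measurable_funX.
  move=> z Dz; have /andP[w0 w1] := wC z Dz.
  rewrite ger0_norm; last by rewrite mulr_ge0 ?sqr_ge0.
  by rewrite ler_pM ?sqr_ge0 ?hB.
have i1 := integrable_scale mD (1 + e) (iw _ bg).
have i2 := integrable_scale mD ((1 + e^-1) * C)
  (sqbounded_integrable finmu (sqboundedB bf bg)).
rewrite /sqdist -!RintegralZl//;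
  [|exact: sqbounded_integrable (sqboundedB bf bg)|exact: iw].
rewrite -RintegralD//; apply: le_Rintegral => //.
- exact: iw.
- exact: integrable_add.
- move=> z Dz; have /andP[w0 w1] := wC z Dz.
  have c0 : 0 < e^-1 by rewrite invr_gt0.
  have ee : e * e^-1 = 1 by rewrite divff// gt_eqF.
  pose b := f z - g z.
  have fg : f z ^+ 2 <= (1 + e) * g z ^+ 2 + (1 + e^-1) * b ^+ 2.
    have : 0 <= e^-1 * (e * g z - b) ^+ 2 by rewrite mulr_ge0 ?sqr_ge0// ltW.
    rewrite (_ : e^-1 * _ = e * (e * e^-1) * g z ^+ 2 -
      2 * (e * e^-1) * (g z * b) + e^-1 * b ^+ 2); last by ring.
    by rewrite ee /b; lra.
  apply: le_trans (ler_wpM2r w0 fg) _; rewrite mulrDl -[_ * w z in leLHS]mulrA.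
  rewrite lerD2l -[leLHS]mulrA -[leRHS]mulrA ler_wpM2l//; first by lra.
  by rewrite mulrC ler_wpM2r// sqr_ge0.
Qed.

(** Cutting [p] off outside of [A] does not give a polynomial, but a polynomial
    multiple [q] of [p] achieves almost the same energies: approximate [\1_A]
    by a trigonometric polynomial [g] and clear the negative powers of [z] in
    it. One [q] serves every measure below [mu]. *)
Lemma energy_indic_mul mu (A : set (borelC R)) (p : {poly R[i]}) (e : R) :
  (mu setT < +oo)%E -> measurable A -> 0 < e ->
  exists q, forall mu' : {measure set (borelC R) -> \bar R},
    (forall B, measurable B -> (mu' B <= mu B)%E) -> mu' (~` D) = 0%E ->
    let I := \int[mu']_(z in D) (\1_A z ^+ 2 * normsq p.[z : R[i]]) in
    energy mu' q <= (1 + e) * I + e /\ I <= (1 + e) * energy mu' q + e.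
Proof.
move=> finmu mA e0; have [C0 pC0] := normsq_horner_bounded p.
pose C := `|C0| + 1; have C_gt0 : 0 < C by rewrite ltr_wpDl.
pose w (z : borelC R) := normsq p.[z : R[i]].
have wC z : D z -> 0 <= w z <= C.
  move=> Dz; rewrite normsq_ge0/=; apply: le_trans (pC0 z Dz) _.
  by apply: le_trans (ler_norm _) _; rewrite lerDl.
have K0 : 0 < (1 + e^-1) * C by rewrite mulr_gt0// addr_gt0 ?invr_gt0.
have [b1 /(_ (e / ((1 + e^-1) * C)))[|g tg gd]] := indic_approximable finmu mA.
  by rewrite divr_gt0.
have bg := trigpoly_sqbounded tg.
have [_ [k [Q gQ]]] := tg.
exists (Q * p) => mu' mu'le mu'D.
have fin' : (mu' setT < +oo)%E by apply: le_lt_trans finmu; exact: mu'le.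
have fm' := circle_finite_moments fin' mu'D.
have mw : measurable_fun setT w.
  exact/measurable_EFinP/measurable_int/(energy_integrable p fm').
have -> : energy mu' (Q * p) = \int[mu']_(z in D) (g z ^+ 2 * w z).
  rewrite /energy (Rintegral_circle mu'D); last exact: energy_integrable.
  apply: eq_Rintegral => z /set_mem Dz; rewrite hornerM normsqM -gQ// normsqM.
  by rewrite normsq_real normsq_circleX// mul1r.
have [mfg [B fgB]] := sqboundedB b1 bg.
have dle : (1 + e^-1) * C * sqdist mu' \1_A g <= e.
  rewrite mulrC -ler_pdivlMr//; apply: le_trans (ltW gd).
  apply: (Rintegral_le_measure (C := B)) => //.
  - exact: measurable_funX.
  - by move=> z; rewrite sqr_ge0.
have dE : sqdist mu' g \1_A = sqdist mu' \1_A g.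
  by apply: eq_Rintegral => z _; rewrite -[LHS]sqrrN opprB.
split.
  apply: le_trans (weighted_sq_le fin' mw wC e0 bg b1) _.
  by rewrite dE lerD2l.
apply: le_trans (weighted_sq_le fin' mw wC e0 b1 bg) _.
by rewrite lerD2l.
Qed.

End Perturbation.

(** * Limits of smallest eigenvalues *)

Section LimitSmallestEigenvalue.
Context {R : realType}.
Local Notation D := (unit_circle R).
Implicit Types (mu : {measure set (borelC R) -> \bar R}).

Lemma lambda_arc_le mu n (p : {poly R[i]}) : finite_moments mu ->
  (size p <= n.+1)%N -> lambda mu n * energy arc p <= energy mu p.
Proof.
exact: lambda_energy_le arc_finite_moments (moment_trunc_arc n).
Qed.

Lemma lambda_arc_attained mu n : finite_moments mu ->
  exists p : {poly R[i]}, [/\ (size p <= n.+1)%N, 0 < energy arc p &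
    energy mu p = lambda mu n * energy arc p].
Proof.
exact: lambda_energy_attained arc_finite_moments (moment_trunc_arc n).
Qed.

Lemma lambda_ge0 mu n : finite_moments mu -> 0 <= lambda mu n.
Proof.
move=> fm; have [p [_ p0 pE]] := lambda_arc_attained n fm.
by rewrite -(pmulr_lge0 _ p0) -pE energy_ge0.
Qed.

Lemma lambda_nonincreasing mu :
  finite_moments mu -> nonincreasing_seq (lambda mu).
Proof.
move=> fm; apply/nonincreasing_seqP => n.
have [p [sp p0 pE]] := lambda_arc_attained n fm.
by rewrite -(ler_pM2r p0) -pE lambda_arc_le// (leq_trans sp).
Qed.

Lemma is_cvg_lambda mu : finite_moments mu -> cvgn (lambda mu).
Proof.
move=> fm; apply: nonincreasing_is_cvgn; first exact: lambda_nonincreasing.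
by exists 0 => _ [n _ <-]; exact: lambda_ge0.
Qed.

Lemma limn_lambda_le mu (q : {poly R[i]}) : finite_moments mu ->
  limn (lambda mu) * energy arc q <= energy mu q.
Proof.
move=> fm; apply: le_trans (lambda_arc_le fm (leqnSn (size q))).
rewrite ler_wpM2r ?energy_ge0//; apply: nonincreasing_cvgn_ge => //.
- exact: lambda_nonincreasing.
- exact: is_cvg_lambda.
Qed.

Lemma finite_moments_finite mu : finite_moments mu -> (mu setT < +oo)%E.
Proof.
move=> /(_ 0%N 0%N)[/integrableP[_ +] _]; rewrite /monomial.
under eq_integral do rewrite !expr0 mulr1/= normr1.
by rewrite integral_cst// mul1e.
Qed.

Lemma energy_le_measure mu1 mu2 (p : {poly R[i]}) :
  (forall A, measurable A -> (mu1 A <= mu2 A)%E) -> (mu2 setT < +oo)%E ->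
  mu1 (~` D) = 0%E -> mu2 (~` D) = 0%E -> energy mu1 p <= energy mu2 p.
Proof.
move=> mu12 fin2 mu1D mu2D.
have fin1 : (mu1 setT < +oo)%E by apply: le_lt_trans fin2; exact: mu12.
have ip := energy_integrable p (circle_finite_moments fin2 mu2D).
rewrite /energy (Rintegral_circle mu1D); last first.
  exact: energy_integrable (circle_finite_moments fin1 mu1D).
rewrite (Rintegral_circle mu2D)//.
have [C pC] := normsq_horner_bounded p.
apply: (Rintegral_le_measure (C := C)) => //.
- exact/measurable_EFinP/measurable_int/ip.
- by move=> z; exact: normsq_ge0.
Qed.

(** Letting [e] tend to 0; [e] is chosen of the order of [(l - L) * s]. *)
Lemma le_of_perturbed_le (l L s : R) : 0 <= l -> 0 <= L -> 0 < s ->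
  (forall e, 0 < e -> l * (s - e) <= (1 + e) * ((1 + e) * (L * s) + e)) ->
  l <= L.
Proof.
move=> l0 L0 s0 key; rewrite leNgt; apply/negP => Ll.
have d0 : 0 < (l - L) * s by rewrite mulr_gt0// subr_gt0.
have Ls0 : 0 <= L * s by rewrite mulr_ge0// ltW.
pose M := l + 3 * (L * s) + 2.
have M0 : 0 < M by rewrite /M; lra.
pose e := Num.min 1 ((l - L) * s / (2 * M)).
have e0 : 0 < e by rewrite lt_min ltr01 divr_gt0// mulr_gt0.
have e1 : e <= 1 by rewrite ge_min lexx.
have eM : e * (2 * M) <= (l - L) * s.
  by rewrite -ler_pdivlMr ?mulr_gt0// ge_min lexx orbT.
have e2 : e ^+ 2 <= e by rewrite expr2 ler_piMr// ltW.
have : e ^+ 2 * (L * s) <= e * (L * s) by rewrite ler_wpM2r.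
by move: (key e e0) eM d0; rewrite /M; lra.
Qed.

End LimitSmallestEigenvalue.

(** * Comparison of the limits *)

Theorem theorem2 (R : realType)
    (nu nu_a nu_s : {measure set (borelC R) -> \bar R}) :
  finite_moments nu ->
  nu (~` unit_circle R) = 0%E ->
  lebesgue_decomposition (arc_measure R) nu nu_a nu_s ->
  [/\ cvgn (lambda nu), cvgn (lambda nu_a)
    & limn (lambda nu) = limn (lambda nu_a)].
Proof.
move=> fm nuD [nuE nu_a_arc [N [mN nu_sN arcN]]].
pose D := unit_circle R; have mD : measurable D := measurable_unit_circle.
have finnu := finite_moments_finite fm.
have le_a A : measurable A -> (nu_a A <= nu A)%E.
  by move=> mA; rewrite nuE// leeDl// measure_ge0.
have le_s A : measurable A -> (nu_s A <= nu A)%E.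
  by move=> mA; rewrite nuE// leeDr// measure_ge0.
have fin_a : (nu_a setT < +oo)%E by apply: le_lt_trans finnu; exact: le_a.
have fin_s : (nu_s setT < +oo)%E by apply: le_lt_trans finnu; exact: le_s.
have nu_aD : nu_a (~` D) = 0%E.
  by apply/eqP; rewrite eq_le measure_ge0 -nuD le_a//; exact: measurableC.
have fm_a := circle_finite_moments fin_a nu_aD.
have nu_aN : nu_a (~` N) = 0%E.
  apply: (null_content_dominatesP _ _).1 nu_a_arc _ _ arcN.
  exact: measurableC.
have cnu := is_cvg_lambda fm; have cnu_a := is_cvg_lambda fm_a.
split; [exact: cnu|exact: cnu_a|].
apply/eqP; rewrite eq_le; apply/andP; split; last first.
  apply: (ler_lim cnu_a cnu); apply: nearW => n.
  have [p [sp p0 pE]] := lambda_arc_attained n fm.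
  have le1 := lambda_arc_le fm_a sp.
  have le2 := energy_le_measure p le_a finnu nu_aD nuD.
  have le3 : energy nu_a p <= lambda nu n * energy arc p by rewrite -pE.
  by have := le_trans le1 le3; rewrite ler_pM2r.
apply: (limr_ge cnu_a); apply: nearW => n.
have [p [_ s0 pE]] := lambda_arc_attained n fm_a.
(* [p] realises the smallest eigenvalue for [nu_a]; it is cut off to [N], which
   carries [arc] and [nu_a] while [nu_s] does not charge it *)
pose w (z : borelC R) := normsq p.[z : R[i]].
have mw : measurable_fun setT w.
  exact/measurable_EFinP/measurable_int/(energy_integrable p fm).
have mNw : measurable_fun setT (fun z => \1_N z ^+ 2 * w z).
  apply: measurable_funM => //; apply: measurable_funX.
  exact: measurable_indic.
have IN (mu : {measure set (borelC R) -> \bar R}) : mu (~` N) = 0%E ->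
    \int[mu]_(z in D) (\1_N z ^+ 2 * w z) = \int[mu]_(z in D) w z.
  move=> muN.
  apply: (Rintegral_eq_ae (measurableC mN) muN) => // z _ /contrapT Nz.
  by rewrite indicE mem_set// expr1n mul1r.
have [C pC] := normsq_horner_bounded p.
have Nw0 z : 0 <= \1_N z ^+ 2 * w z by rewrite mulr_ge0 ?sqr_ge0 ?normsq_ge0.
have bNw z : D z -> `|\1_N z ^+ 2 * w z| <= C.
  move=> Dz; rewrite ger0_norm//; apply: le_trans (pC z Dz).
  rewrite indicE; case: (_ \in _); first by rewrite expr1n mul1r.
  by rewrite expr0n mul0r normsq_ge0.
have I_arc : \int[arc]_(z in D) (\1_N z ^+ 2 * w z) = energy arc p.
  rewrite IN// /energy (Rintegral_circle arc_setC_circle)//.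
  exact: energy_integrable arc_finite_moments.
have I_nu : \int[nu]_(z in D) (\1_N z ^+ 2 * w z) = energy nu_a p.
  rewrite /energy (Rintegral_circle nu_aD); last exact: energy_integrable.
  transitivity (\int[nu_a]_(z in D) (\1_N z ^+ 2 * w z) +
                \int[nu_s]_(z in D) (\1_N z ^+ 2 * w z)).
    rewrite /Rintegral -fineD; last 2 first.
      exact: integrable_fin_num (bounded_integrable fin_a mNw bNw).
      exact: integrable_fin_num (bounded_integrable fin_s mNw bNw).
    rewrite -ge0_integral_measure_add//; last 2 first.
      by move=> z _; rewrite lee_fin.
      exact/measurable_funTS/measurable_EFinP.
    congr fine; apply: eq_measure_integral => A mA _.
    by rewrite nuE//; exact: (esym (measure_addE nu_a nu_s A)).
  rewrite IN// (Rintegral_eq_ae (h2 := cst 0) mN nu_sN)//; last first.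
    by move=> z _ Nz; rewrite indicE memNset// expr0n mul0r.
  by rewrite Rintegral_cst// mul0r addr0.
have fin_sum : (measure_add arc nu setT < +oo)%E.
  by rewrite measure_addE arc_setT lte_add_pinfty// ltry.
apply: (le_of_perturbed_le (s := energy arc p)) => //.
- by apply: (limr_ge cnu); apply: nearW => k; exact: lambda_ge0.
- exact: lambda_ge0.
- move=> e e0; have [q qP] := energy_indic_mul p fin_sum mN e0.
  have [|+ _] := qP nu _ nuD.
    move=> B mB; rewrite [leRHS](_ : _ = (arc B + nu B)%E).
      by rewrite leeDr// measure_ge0.
    exact: measure_addE.
  rewrite I_nu pE => qnu.
  have [|_] := qP arc _ arc_setC_circle.
    move=> B mB; rewrite [leRHS](_ : _ = (arc B + nu B)%E).
      by rewrite leeDl// measure_ge0.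
    exact: measure_addE.
  rewrite I_arc => qarc.
  have lq := le_trans (limn_lambda_le q fm) qnu.
  apply: (@le_trans _ _ ((1 + e) * (limn (lambda nu) * energy arc q))).
    rewrite mulrCA ler_wpM2l ?lerBlDr//.
    by apply: (limr_ge cnu); apply: nearW => k; exact: lambda_ge0.
  by rewrite ler_wpM2l//; lra.
Qed.
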